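(* If $H$ is a hypergraph with maximum hyperedge cardinality $\overline{\Delta}$ and no isolated vertices, then $b_L(H)\le |V(H)|-\left\lceil \frac{|V(H)|}{\overline{\Delta}}\right\rceil$.
   Context: A hypergraph $H$ consists of a finite vertex set $V(H)$ and a finite collection $E(H)$ of subsets of $V(H)$. An isolated vertex is one contained in no hyperedge. Lazy burning: a set $B\subseteq V(H)$ is burned initially; in each subsequent round every unburned vertex $v$ for which some hyperedge $h\ni v$ has $h\setminus\{v\}$ entirely burned becomes burned. $B$ is a lazy burning set if eventually all vertices burn; $b_L(H)$ is the minimum size of a lazy burning set. *)

(* Defs.v *)
From HB Require Import structures.
From mathcomp Require Import all_boot all_order all_algebra.

Set Implicit Arguments.
Unset Strict Implicit.
Unset Printing Implicit Defensive.

(* Hyperedges form a sequence, so parallel, singleton and empty hyperedges are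
   all allowed. *)
Record hypergraph := Hypergraph {
  vertices : finType;
  edges : seq {set vertices}
}.

Definition isolated (H : hypergraph) (v : vertices H) : bool :=
  ~~ has (fun h : {set vertices H} => v \in h) (edges H).

(* If there are no hyperedges this is 0. *)
Definition max_edge_card (H : hypergraph) : nat :=
  \max_(h <- edges H) #|h|.

(* When [h = [set v]], the condition [h :\ v \subset B] holds vacuously, so [v]
   burns in the first round. *)
Definition burn_round (H : hypergraph) (B : {set vertices H}) :
    {set vertices H} :=
  B :|: [set v | has (fun h : {set vertices H} =>
                        (v \in h) && (h :\ v \subset B)) (edges H)].

Definition lazy_burning_set (H : hypergraph) (B : {set vertices H}) : Prop :=
  exists r : nat, iter r (@burn_round H) B = [set: vertices H].

(* Decides [lazy_burning_set], see [lazy_burning_setP]: the fire stops spreading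
   after at most #|V(H)| rounds. *)
Definition lazy_burning_setb (H : hypergraph) (B : {set vertices H}) : bool :=
  iter #|vertices H| (@burn_round H) B == [set: vertices H].

Lemma subset_burn_round (H : hypergraph) (B : {set vertices H}) :
  B \subset burn_round B.
Proof. exact: subsetUl. Qed.

Lemma lazy_burning_setP (H : hypergraph) (B : {set vertices H}) :
  reflect (lazy_burning_set B) (lazy_burning_setb B).
Proof.
apply: (iffP eqP) => [burnB | [r burnB]]; first by exists #|vertices H|.
pose f := @burn_round H; set n := #|vertices H|.
have stable k : f (iter k f B) = iter k f B ->
    forall m, k <= m -> iter m f B = iter k f B.
  move=> fixk m /subnK <-; elim: (m - k) => //= j IHj.
  by rewrite IHj.
have [k le_kn fixk] : exists2 k, k <= n & f (iter k f B) = iter k f B.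
  have /orP[/existsP[k /eqP fixk] | big] :
      [exists k : 'I_n.+1, f (iter k f B) == iter k f B]
      || (n.+1 <= #|iter n.+1 f B|).
    case: existsP => //= nofix.
    have: forall m, m <= n.+1 -> m <= #|iter m f B|.
      elim=> // m IHm lt_mn; apply: leq_ltn_trans (IHm (ltnW lt_mn)) _.
      apply: proper_card; rewrite properEneq subset_burn_round andbT.
      apply/eqP => fixm; case: nofix.
      by exists (Ordinal lt_mn); rewrite /= -[X in _ == X]/(iter m f B) [X in _ == X]fixm.
    exact.
  - by exists k => //; rewrite -ltnS.
  - by have := leq_trans big (max_card _); rewrite ltnn.
rewrite (stable k fixk n le_kn).
case: (leqP k r) => [le_kr | /ltnW le_rk].
  by rewrite -(stable k fixk r le_kr).
apply/eqP; rewrite -subTset -burnB -/f -(subnK le_rk).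
elim: (k - r) => //= j IHj.
exact: subset_trans IHj (subset_burn_round _).
Qed.

Definition lazy_burning_number (H : hypergraph) : nat :=
  #|[arg min_(B < [set: vertices H] | lazy_burning_setb B) #|B|]|.

Lemma lazy_burning_setT (H : hypergraph) : lazy_burning_set [set: vertices H].
Proof. by exists 0. Qed.

Lemma lazy_burning_number_min (H : hypergraph) :
  (exists2 B : {set vertices H},
     lazy_burning_set B & #|B| = lazy_burning_number H) /\
  (forall B : {set vertices H},
     lazy_burning_set B -> lazy_burning_number H <= #|B|).
Proof.
rewrite /lazy_burning_number; case: arg_minnP => [|B burnB minB].
  exact/lazy_burning_setP/lazy_burning_setT.
split; first by exists B => //; apply/lazy_burning_setP.
by move=> C /lazy_burning_setP/minB.
Qed.

(* Main.v *)
Require Import Defs.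
From HB Require Import structures.
From mathcomp Require Import all_boot all_order all_algebra.
Import Order.TTheory GRing.Theory Num.Theory.
Local Open Scope ring_scope.

(* Greedy choice: as long as some vertex [v] is unburned, take a hyperedge [h]
   through [v] and ignite the unburned vertices of [h] other than [v], so that
   [v] burns by propagation. Each such step burns at most [max_edge_card H] new
   vertices and spares exactly one of them from ignition, so at least
   [#|vertices H| / max_edge_card H] vertices are never ignited. *)

Lemma burn_roundS (H : hypergraph) (A B : {set vertices H}) :
  A \subset B -> burn_round A \subset burn_round B.
Proof.
move=> sAB; apply: setUSS => //; apply/subsetP => v; rewrite !inE.
by apply: sub_has => h /= /andP[-> /subset_trans ->].
Qed.

Lemma iter_burn_roundS (H : hypergraph) (A B : {set vertices H}) (r : nat) :
  A \subset B ->
  iter r (@burn_round H) A \subset iter r (@burn_round H) B.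
Proof. by move=> sAB; elim: r => //= r; apply: burn_roundS. Qed.

Lemma subset_iter_burn_round (H : hypergraph) (B : {set vertices H}) (r : nat) :
  B \subset iter r (@burn_round H) B.
Proof.
by elim: r => //= r /subset_trans; apply; apply: subset_burn_round.
Qed.

Lemma max_edge_card_ge (H : hypergraph) (h : {set vertices H}) :
  h \in edges H -> (#|h| <= max_edge_card H)%N.
Proof. by move=> hE; apply: leq_bigmax_seq. Qed.

(** By monotonicity the enlarged fire still covers [S] after [r] rounds. Every vertex of [h] other
    than [v] is then in [S] or was ignited, so one extra round burns [v] through [h]. *)
Lemma ignite_edge (H : hypergraph) (h S B : {set vertices H}) (v : vertices H)
    (r : nat) :
  h \in edges H -> v \in h -> S \subset iter r (@burn_round H) B ->
  S :|: h \subset iter r.+1 (@burn_round H) (B :|: (h :\: S) :\ v).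
Proof.
move=> hE vh sSB; set B' := B :|: _.
have sS : S \subset iter r (@burn_round H) B'.
  exact: subset_trans sSB (iter_burn_roundS _ _ _ _ (subsetUl _ _)).
have sh : h :\ v \subset iter r (@burn_round H) B'.
  apply/subsetP => x; rewrite !inE => /andP[xv xh].
  have [/(subsetP sS) //|xS] := boolP (x \in S).
  apply: (subsetP (subset_iter_burn_round _ _ _)).
  by rewrite !inE xv xS xh orbT.
rewrite subUset (subset_trans sS (subset_burn_round _)) /=.
rewrite -(setD1K vh) subUset (subset_trans sh (subset_burn_round _)) andbT.
rewrite sub1set !inE; apply/orP; right; apply/hasP; exists h => //.
by rewrite vh sh.
Qed.

(** The last conjunct is a division-free form of the bound of #|B| by #|S| - #|S| /
    [max_edge_card H]. The parameter [k] only bounds #|S| from below, since one hyperedge may add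
    several vertices at once. *)
Lemma greedy_burning (H : hypergraph)
  (no_isolated : forall v : vertices H, ~~ isolated v) (k : nat) :
  (k <= #|vertices H|)%N ->
  exists S B : {set vertices H}, exists r : nat,
    [/\ (k <= #|S|)%N, S \subset iter r (@burn_round H) B &
        (#|S| + max_edge_card H * #|B| <= max_edge_card H * #|S|)%N].
Proof.
elim: k => [_|k IHk lt_kn].
  by exists set0, set0, 0%N; rewrite !cards0 muln0 sub0set.
have [S [B [r [le_kS sSB cSB]]]] := IHk (ltnW lt_kn).
(* If the previous step overshot [k], nothing is to be done; otherwise [S] misses some vertex. *)
have [lt_kS|le_Sk] := ltnP k #|S|; first by exists S, B, r.
have [v vS] : exists v, v \notin S.
  apply/existsP; rewrite -negb_forall; apply: contraL lt_kn => /forallP allS.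
  by rewrite -leqNgt (leq_trans _ le_Sk) // subset_leq_card //; apply/subsetP.
have /negPn/hasP[h hE vh] := no_isolated v.
exists (S :|: h), (B :|: (h :\: S) :\ v), r.+1.
have cvh : #|h :\: S| = (#|(h :\: S) :\ v|).+1.
  by rewrite (cardsD1 v (h :\: S)) inE vS vh add1n.
have cSh : #|S :|: h| = (#|S| + (#|(h :\: S) :\ v|).+1)%N.
  by rewrite -cvh cardsD cardsU setIC addnBA // subset_leq_card ?subsetIl.
split; first by rewrite cSh addnS ltnS (leq_trans le_kS) ?leq_addr.
  exact: ignite_edge.
have cB : (#|B :|: (h :\: S) :\ v| <= #|B| + #|(h :\: S) :\ v|)%N.
  by rewrite -cardsUI leq_addr.
have ch : ((#|(h :\: S) :\ v|).+1 <= max_edge_card H)%N.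
  apply: leq_trans (max_edge_card_ge _ _ hE).
  by rewrite -cvh subset_leq_card ?subsetDl.
(* With d = #|h :\: S| and D = [max_edge_card H], the left side grows by at most d + D(d - 1) and
   the right side by D d, so d <= D suffices. *)
rewrite cSh.
apply: leq_trans (leq_add (leqnn _) (leq_mul (leqnn _) cB)) _.
by rewrite !mulnDr mulnS addnACA leq_add // leq_add2r.
Qed.

Lemma exists_lazy_burning_set (H : hypergraph)
  (no_isolated : forall v : vertices H, ~~ isolated v) :
  exists2 B : {set vertices H}, lazy_burning_set B &
    (#|vertices H| + max_edge_card H * #|B|
       <= max_edge_card H * #|vertices H|)%N.
Proof.
have [S [B [r [leS sSB]]]] := greedy_burning H no_isolated _ (leqnn _).
have ST : S = [set: vertices H] by apply/eqP; rewrite eqEcard subsetT cardsT.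
rewrite {}ST cardsT in sSB * => cB; exists B => //; exists r.
by apply/eqP; rewrite -subTset.
Qed.

Theorem theorem2p16 (H : hypergraph)
  (no_isolated : forall v : vertices H, ~~ isolated v) :
  (lazy_burning_number H)%:Z <=
    #|vertices H|%:Z - Num.ceil (#|vertices H|%:Q / (max_edge_card H)%:Q).
Proof.
have [B burnB cB] := exists_lazy_burning_set H no_isolated.
have leB := (lazy_burning_number_min H).2 B burnB.
(* The ceiling disappears because it is compared with an integer. *)
rewrite lerBrDl -lerBrDr ceil_le_int.
(* When the denominator is 0, [cB] leaves no vertices, so the quotient is 0 because its numerator
   is. *)
have [D0|D_gt0] := posnP (max_edge_card H).
  move: cB; rewrite D0 !mul0n addn0 leqn0 => /eqP n0.
  have le_bn := leq_trans leB (max_card (mem B)).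
  by rewrite {1}n0 mul0r ler0z subr_ge0 lez_nat.
rewrite ler_pdivrMr ?ltr0z // -intrM ler_int mulrBl lerBrDr.
rewrite -!PoszM -PoszD lez_nat ![(_ * max_edge_card H)%N]mulnC.
by apply: leq_trans cB; rewrite leq_add2l leq_mul2l leB orbT.
Qed.
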